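(* If $H$ is a bipartite graph having Sidorenko's property, then $K_2\,\square\,H$ has Sidorenko's property.
   Context: All graphs are finite and simple. $t_H(G)=|\mathrm{Hom}(H,G)|/|V(G)|^{|V(H)|}$, where $\mathrm{Hom}(H,G)$ is the set of graph homomorphisms from $H$ to $G$. A bipartite graph $H$ has Sidorenko's property if $t_H(G)\ge t_{K_2}(G)^{|E(H)|}$ for all graphs $G$. The Cartesian product $H_1\,\square\,H_2$ is the graph on $V(H_1)\times V(H_2)$ in which $(u_1,u_2)$ and $(v_1,v_2)$ are adjacent iff either $u_1v_1\in E(H_1)$ and $u_2=v_2$, or $u_2v_2\in E(H_2)$ and $u_1=v_1$. *)

(* Defs.v *)
From mathcomp Require Import all_boot all_order all_algebra.

Set Implicit Arguments.
Unset Strict Implicit.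
Unset Printing Implicit Defensive.

Import Order.TTheory GRing.Theory Num.Theory.

Record sgraph := SGraph {
  vertex :> finType;
  adj : rel vertex;
  adj_sym : symmetric adj;
  adj_irr : irreflexive adj }.

Definition edges (G : sgraph) : {set {set G}} :=
  [set e : {set G} | [exists x, exists y, adj x y && (e == [set x; y])]].

Definition bipartite (G : sgraph) : Prop :=
  exists A : {set G}, forall x y : G, adj x y -> (x \in A) != (y \in A).

Definition hom (H G : sgraph) : {set {ffun H -> G}} :=
  [set f : {ffun H -> G} | [forall x, forall y, adj x y ==> adj (f x) (f y)]].

Definition hom_density (H G : sgraph) : rat :=
  (#|hom H G|%:R / #|G|%:R ^+ #|H|)%R.

Section Complete.
Variable n : nat.

Definition complete_adj : rel 'I_n := fun x y => x != y.

Lemma complete_adj_sym : symmetric complete_adj.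
Proof. by move=> x y; rewrite /complete_adj eq_sym. Qed.

Lemma complete_adj_irr : irreflexive complete_adj.
Proof. by move=> x; rewrite /complete_adj eqxx. Qed.

Definition complete_graph : sgraph := SGraph complete_adj_sym complete_adj_irr.

End Complete.

Notation K_2 := (complete_graph 2).

Section CartesianProduct.
Variables H1 H2 : sgraph.

Definition cart_adj : rel (H1 * H2)%type := fun u v =>
  (adj u.1 v.1 && (u.2 == v.2)) || (adj u.2 v.2 && (u.1 == v.1)).

Lemma cart_adj_sym : symmetric cart_adj.
Proof.
by move=> u v; rewrite /cart_adj !(adj_sym u.1) !(adj_sym u.2) ![u.1 == _]eq_sym
  ![u.2 == _]eq_sym.
Qed.

Lemma cart_adj_irr : irreflexive cart_adj.
Proof. by move=> u; rewrite /cart_adj !adj_irr. Qed.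

Definition cart_prod : sgraph := SGraph cart_adj_sym cart_adj_irr.

End CartesianProduct.

(* The density t_H(G) divides by |V(G)|^|V(H)|, so G ranges over graphs with at
   least one vertex; for the null graph the quotient would be the junk value
   0 / 0 = 0. *)
Definition sidorenko (H : sgraph) : Prop :=
  bipartite H /\
  forall G : sgraph, 0 < #|G| ->
    (hom_density K_2 G ^+ #|edges H| <= hom_density H G)%R.

(* Main.v *)
(** Homomorphisms from [K_2 □ H] to [G] are the homomorphisms from [H] to the
    graph [square_graph G] whose vertices are the arcs (ordered edges) of [G],
    two arcs being adjacent when they are opposite sides of a homomorphic
    4-cycle.  If [G] has [n] vertices and edge density [p], then
    [square_graph G] has [p n^2] vertices, and two applications of
    Cauchy-Schwarz show that it has at least [p^4 n^4] arcs, hence edge density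
    at least [p^2].  Sidorenko's property of [H] on [square_graph G] thus gives
    at least [p^(2 e(H)) (p n^2)^v(H)] homomorphisms, which is the claim since
    [K_2 □ H] has [2 e(H) + v(H)] edges. *)
From mathcomp Require Import all_boot all_order all_algebra.
Require Import Defs.

Set Implicit Arguments.
Unset Strict Implicit.
Unset Printing Implicit Defensive.

Import Order.TTheory GRing.Theory Num.Theory.

Definition arcs (G : sgraph) : {set G * G} := [set p | adj p.1 p.2].

Lemma card_arcsE (G : sgraph) :
  #|arcs G| = \sum_(x : G) \sum_(y : G) (adj x y : nat).
Proof.
rewrite pair_big /= -sum1dep_card big_mkcond /=.
by apply: eq_bigr => p _; case: adj.
Qed.

(** Sending an arc to its set of endpoints has fibres of size two, since there are no loops. *)
Lemma card_arcs_edges (G : sgraph) : #|arcs G| = 2 * #|edges G|.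
Proof.
pose h (p : G * G) := [set p.1; p.2].
have hE p : p \in arcs G -> h p \in edges G.
  rewrite !inE => ap; apply/existsP; exists p.1; apply/existsP; exists p.2.
  by rewrite ap eqxx.
rewrite -sum1_card (partition_big h (mem (edges G))) //=.
rewrite mulnC -sum_nat_const; apply: eq_bigr => e.
rewrite inE => /existsP[x /existsP[y /andP[axy /eqP->]]].
have nxy : x != y by apply: contraTneq axy => ->; rewrite adj_irr.
rewrite sum1dep_card -(_ : #|[set (x, y); (y, x)]| = 2); last first.
  by rewrite cards2 xpair_eqE negb_and nxy.
apply: eq_card => -[a b]; rewrite !inE /= !xpair_eqE.
apply/andP/orP => [[ab /eqP exy]|].
  have nab : a != b by apply: contraTneq ab => ->; rewrite adj_irr.
  have := set21 a b; have := set22 a b; rewrite -/(h (a, b)) exy !inE.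
  move=> /orP[]/eqP eb /orP[]/eqP ea; move: nab; rewrite ea eb ?eqxx //=.
    by right.
  by left.
case=> /andP[/eqP-> /eqP->]; first by rewrite axy /h /=.
by rewrite adj_sym axy /h /= setUC.
Qed.

Lemma card_hom_K2 (G : sgraph) : #|hom K_2 G| = #|arcs G|.
Proof.
pose h (f : {ffun K_2 -> G}) := (f ord0, f ord_max).
have h_inj : injective h.
  move=> f g [e0 e1]; apply/ffunP => -[[|[|//]] lt_i].
    by rewrite (_ : Ordinal _ = ord0) //; apply: val_inj.
  by rewrite (_ : Ordinal _ = ord_max) //; apply: val_inj.
rewrite -(card_imset _ h_inj); apply: eq_card => -[x y]; rewrite !inE /=.
apply/imsetP/idP => [[f]|axy].
  rewrite inE => /forallP/(_ ord0)/forallP/(_ ord_max)/implyP fP [-> ->].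
  exact: fP.
exists [ffun i : 'I_2 => if i == ord0 then x else y]; last first.
  by rewrite /h !ffunE.
rewrite inE; apply/forallP => i; apply/forallP => j; apply/implyP.
rewrite !ffunE; case: i j => [[|[|//]] lt_i] [[|[|//]] lt_j] //= _.
by rewrite adj_sym.
Qed.

Lemma card_edges_cart_K2 (H : sgraph) :
  #|edges (cart_prod K_2 H)| = 2 * #|edges H| + #|H|.
Proof.
apply/eqP; rewrite -(eqn_pmul2l (isT : 0 < 2)) -card_arcs_edges.
rewrite mulnDr -card_arcs_edges !card_arcsE; apply/eqP.
(* [F i j] counts arcs from copy [i] of [H] to copy [j]: all arcs of [H] when [i = j], a perfect
   matching otherwise. *)
pose F (i j : 'I_2) := \sum_(x : H) \sum_(y : H)
  (((i != j) && (x == y)) || (adj x y && (i == j)) : nat).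
transitivity (\sum_i \sum_j F i j).
  rewrite -(pair_big xpredT xpredT (fun (i : 'I_2) (x : H) =>
    \sum_(v : 'I_2 * H) (@adj (cart_prod K_2 H) (i, x) v : nat))) /=.
  apply: eq_bigr => i _; rewrite [RHS]exchange_big /=; apply: eq_bigr => x _.
  by rewrite -(pair_big xpredT xpredT (fun (j : 'I_2) (y : H) =>
    (@adj (cart_prod K_2 H) (i, x) (j, y) : nat))).
have Feq i : F i i = \sum_(x : H) \sum_(y : H) (adj x y : nat).
  apply: eq_bigr => x _; apply: eq_bigr => y _.
  by rewrite !eqxx /= andbT.
have Fneq i j : i != j -> F i j = #|H|.
  move=> nij; rewrite -sum1_card; apply: eq_bigr => x _.
  rewrite (bigD1 x) //= (negbTE nij) eqxx big1 => [|y /negbTE nyx].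
    by rewrite /= addn0.
  by rewrite andbF orbF eq_sym nyx.
rewrite !big_ord_recl !big_ord0 !Feq !Fneq //.
by rewrite !addn0 !mul2n -!addnn addnACA [X in _ + X]addnC addnACA.
Qed.

(** Cauchy-Schwarz against the constant 1, by summing [2ab <= a^2 + b^2] over all pairs of
    indices. *)
Lemma sqr_sum_le_card (I : finType) (F : I -> nat) :
  (\sum_i F i) ^ 2 <= #|I| * \sum_i F i ^ 2.
Proof.
rewrite -(leq_pmul2l (isT : 0 < 2)) -mulnn big_distrlr /=.
have -> : 2 * (#|I| * \sum_i F i ^ 2) = \sum_i \sum_j (F i ^ 2 + F j ^ 2).
  under [RHS]eq_bigr do rewrite big_split sum_nat_const /=.
  by rewrite big_split /= sum_nat_const -big_distrr /= mul2n -addnn.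
rewrite big_distrr; apply: leq_sum => i _; rewrite big_distrr.
by apply: leq_sum => j _; apply: nat_Cauchy.
Qed.

Section SquareGraph.
Variable G : sgraph.

Definition square_vertex := {p : G * G | adj p.1 p.2}.

Definition square_adj : rel square_vertex := fun u v =>
  adj (val u).1 (val v).1 && adj (val u).2 (val v).2.

Lemma square_adj_sym : symmetric square_adj.
Proof. by move=> u v; congr (_ && _); apply: adj_sym. Qed.

Lemma square_adj_irr : irreflexive square_adj.
Proof. by move=> u; rewrite /square_adj adj_irr. Qed.

Definition square_graph : sgraph := SGraph square_adj_sym square_adj_irr.

Lemma card_square_graph : #|square_graph| = #|arcs G|.
Proof. by rewrite card_sig; apply: eq_card => p; rewrite !inE. Qed.

(* The arc from [(x, y)] to [(x', y')] is the closed walk [x, y, y', x'], here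
   counted by the diagonal [(x', y)] and its common neighbours [x] and [y']. *)
Lemma card_arcs_square_graph :
  #|arcs square_graph| =
  \sum_(p : G * G) (\sum_(z : G) adj z p.1 * adj z p.2) ^ 2.
Proof.
pose h (q : square_graph * square_graph) := (val q.1, val q.2).
have h_inj : injective h by move=> [u v] [u' v'] [/val_inj-> /val_inj->].
rewrite -(card_imset _ h_inj).
pose A := [set q : (G * G) * (G * G) | [&& adj q.1.1 q.1.2, adj q.2.1 q.2.2,
  adj q.1.1 q.2.1 & adj q.1.2 q.2.2]].
have -> : #|h @: arcs square_graph| = #|A|.
  apply: eq_card => -[p q]; rewrite inE /=.
  apply/imsetP/and4P => [[[u v]]|[ap aq a1 a2]].
    by rewrite inE => /andP[a1 a2] [-> ->]; have := (valP u, valP v) => -[].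
  exists (exist _ p ap, exist _ q aq) => //.
  by rewrite inE; apply/andP.
(* Exchanging first endpoints turns two opposite sides into the two diagonals; each end of one
   diagonal is a common neighbour of the ends of the other. *)
pose sw (q : (G * G) * (G * G)) := ((q.2.1, q.1.2), (q.1.1, q.2.2)).
have swK : involutive sw by move=> [[a b] [c d]].
transitivity (\sum_(p : G * G) \sum_(q : G * G) (sw (p, q) \in A : nat)).
  rewrite -sum1_card big_mkcond (reindex_inj (inv_inj swK)) /=.
  by rewrite pair_big; apply: eq_bigr => -[p q] _; case: (_ \in _).
apply: eq_bigr => -[a b] _; rewrite -mulnn big_distrlr pair_big /=.
apply: eq_bigr => -[z w] _ /=; rewrite inE /= [adj b w]adj_sym [adj a w]adj_sym.
by case: (adj z a); case: (adj z b); case: (adj w a); case: (adj w b).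
Qed.

Lemma card_arcs_square_graph_ge :
  #|arcs G| ^ 4 <= #|G| ^ 4 * #|arcs square_graph|.
Proof.
(* [P] counts walks of length two. Grouped by midpoint it is the sum of squared degrees; grouped by
   endpoints, the sum of codegrees. Cauchy-Schwarz is applied once to each grouping. *)
pose P := \sum_(p : G * G) \sum_(z : G) adj z p.1 * adj z p.2.
have arcs_le : #|arcs G| ^ 2 <= #|G| * P.
  suff -> : P = \sum_(z : G) (\sum_(x : G) (adj z x : nat)) ^ 2.
    by rewrite card_arcsE sqr_sum_le_card.
  rewrite /P exchange_big; apply: eq_bigr => z _.
  by rewrite -mulnn big_distrlr pair_big.
have P_le : P ^ 2 <= #|G| ^ 2 * #|arcs square_graph|.
  by rewrite card_arcs_square_graph -[#|G| ^ 2]mulnn -card_prod sqr_sum_le_card.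
apply: (@leq_trans ((#|G| * P) ^ 2)); first by rewrite (expnM _ 2 2) leq_exp2r.
by rewrite expnMn (expnD _ 2 2) -mulnA leq_mul2l P_le orbT.
Qed.

(** The two ends of the arc assigned to a vertex of [H] are its images in the two copies of [H];
    they determine the arc. *)
Lemma card_hom_square_graph (H : sgraph) :
  #|hom H square_graph| <= #|hom (cart_prod K_2 H) G|.
Proof.
pose h (f : {ffun H -> square_graph}) : {ffun cart_prod K_2 H -> G} :=
  [ffun u => if u.1 == ord0 then (val (f u.2)).1 else (val (f u.2)).2].
have h_inj : injective h.
  move=> f g /ffunP eq_fg; apply/ffunP => x; apply: val_inj.
  have e1 := eq_fg (ord0, x); have e2 := eq_fg (ord_max, x).
  rewrite !ffunE /= in e1 e2.
  by rewrite [LHS]surjective_pairing e1 e2 -surjective_pairing.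
rewrite -(card_imset _ h_inj); apply: subset_leq_card; apply/subsetP => k.
case/imsetP=> f; rewrite inE => /forallP fP ->{k}; rewrite inE.
apply/forallP => -[i x]; apply/forallP => -[j y]; apply/implyP.
rewrite !ffunE /= /cart_adj /=.
case/orP=> /andP[].
  move=> nij /eqP <-; have := valP (f x).
  case: i j nij => [[|[|//]] lt_i] [[|[|//]] lt_j] //= _.
  by rewrite adj_sym.
move=> axy /eqP <-.
by have /forallP/(_ y)/implyP/(_ axy)/andP[] := fP x; case: ifP.
Qed.

End SquareGraph.

(** An edge of the product changes exactly one of the two colours, hence their sum modulo 2. *)
Lemma bipartite_cart_K2 (H : sgraph) : bipartite H -> bipartite (cart_prod K_2 H).
Proof.
case=> A AP; exists [set u : cart_prod K_2 H | (u.1 == ord0) (+) (u.2 \in A)].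
move=> [i x] [j y] /= /orP[] /andP[] /=; rewrite !inE /=.
  move=> nij /eqP <-.
  by case: i j nij => [[|[|//]] lt_i] [[|[|//]] lt_j] //= _; case: (x \in A).
by move=> /AP nA /eqP <-; case: (i == ord0); move: nA; case: (x \in A); case: (y \in A).
Qed.

Local Open Scope ring_scope.

Lemma hom_density_K2 (G : sgraph) :
  hom_density K_2 G = #|arcs G|%:R / #|G|%:R ^+ 2.
Proof. by rewrite /hom_density card_hom_K2 card_ord. Qed.

(** With [m] arcs and [n] vertices in [G], clearing denominators leaves
    [m^4 <= n^4 * #|arcs (square_graph G)|]. Here [m] is also the order of [square_graph G], so it
    must be positive. *)
Lemma hom_density_square_graph (G : sgraph) : (0 < #|G|)%N -> (0 < #|arcs G|)%N ->
  hom_density K_2 G ^+ 2 <= hom_density K_2 (square_graph G).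
Proof.
move=> G_gt0 arcs_gt0; rewrite !hom_density_K2 card_square_graph.
have n_gt0 : 0 < #|G|%:R :> rat by rewrite ltr0n.
have m_gt0 : 0 < #|arcs G|%:R :> rat by rewrite ltr0n.
rewrite expr_div_n -exprM ler_pdivrMr ?exprn_gt0 // mulrAC.
rewrite ler_pdivlMr ?exprn_gt0 // -exprD mulrC.
by rewrite -!natrX -natrM ler_nat card_arcs_square_graph_ge.
Qed.

Theorem theorem3p3 (H : sgraph) (bipH : bipartite H) (sidH : sidorenko H) :
  sidorenko (cart_prod K_2 H).
Proof.
split=> [|G G_gt0]; first exact: bipartite_cart_K2.
have n_gt0 : 0 < #|G|%:R :> rat by rewrite ltr0n.
have density_ge0 (F K : sgraph) : 0 <= hom_density F K.
  by rewrite divr_ge0 ?exprn_ge0 ?ler0n.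
have card_cart : #|cart_prod K_2 H| = (2 * #|H|)%N by rewrite card_prod card_ord.
rewrite card_edges_cart_K2.
(* Without arcs [square_graph G] is null and [sidH] says nothing about it. The left side is then 0,
   unless [H] is null, when both sides are 1. *)
have [arcs0|arcs_gt0] := posnP #|arcs G|.
  have [H0|H_gt0] := posnP #|H|; last first.
    by rewrite hom_density_K2 arcs0 mul0r exprD [0 ^+ #|H|]expr0n gtn_eqF ?mulr0.
  have edgesH0 : #|edges H| = 0%N.
    apply: eq_card0 => e; rewrite inE; apply/existsP => -[x _].
    by have := fintype0 x H0.
  rewrite edgesH0 H0 expr0 /hom_density card_cart H0 expr0 divr1 ler1n card_gt0.
  apply/set0Pn; exists [ffun u => False_rect G (fintype0 u.2 H0)].
  by rewrite inE; apply/forallP => u; case: (fintype0 u.2 H0).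
have [_ /(_ (square_graph G))] := sidH; rewrite card_square_graph => /(_ arcs_gt0).
have p_le := hom_density_square_graph G_gt0 arcs_gt0.
move/(le_trans (lerXn2r #|edges H| _ _ p_le)); rewrite !nnegrE exprn_ge0 //.
move=> /(_ isT (density_ge0 _ _)) sid.
(* The factor [(m / n^2)^#|H|], with [m] arcs and [n] vertices in [G], cancels the denominator
   [m^#|H|] of [hom_density H (square_graph G)]. *)
rewrite exprD exprM (le_trans (ler_wpM2r _ sid)) ?exprn_ge0 //.
rewrite hom_density_K2 /hom_density card_square_graph card_cart expr_div_n.
rewrite mulrA divfK ?expf_neq0 ?pnatr_eq0 -?lt0n // -exprM.
by rewrite ler_wpM2r ?invr_ge0 ?exprn_ge0 ?ler0n // ler_nat card_hom_square_graph.
Qed.
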